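(* For every $n \ge 2$, $$h(\mathrm{sd}^2(\partial \Delta_n), x) \ = \ \sum_{\tau \in \mathcal{A}^{\pm}_n} x^{\mathrm{edes}_B(\tau)} \ = \ \sum_{i=0}^{\lfloor (n-1)/2 \rfloor} \gamma_{n,2,i}\, x^i (1+x)^{n-1-2i},$$ where $\gamma_{n,2,i}$ is equal to $4^i$ times the number of words $\sigma \in \mathcal{A}_n$ (counted with multiplicity) with $\mathrm{lpeak}(\sigma) = i$.
   Context: For a simplicial complex $\Delta$ of dimension $d-1$, with $f_{i-1}(\Delta)$ faces of dimension $i-1$ (and $f_{-1}(\Delta)=1$), the $h$-polynomial is $h(\Delta,x) = \sum_{i=0}^{d} f_{i-1}(\Delta)\, x^i (1-x)^{d-i}$. The barycentric subdivision $\mathrm{sd}(\Delta)$ is the simplicial complex of all chains (with respect to inclusion) of nonempty faces of $\Delta$, and $\mathrm{sd}^2(\Delta) = \mathrm{sd}(\mathrm{sd}(\Delta))$. $\partial\Delta_n$ is the boundary complex of the $(n-1)$-dimensional simplex $\Delta_n$, i.e. the complex of all proper subsets of an $n$-element set. Write $[m]=\{1,\dots,m\}$. $\mathcal{A}_n$ is the multiset $M_1 \times M_2 \times \cdots \times M_{n-1}$ of words $\sigma = (\sigma_1,\dots,\sigma_{n-1})$, where $M_k$ is the multiset in which each $i \in [k]$ appears exactly $k+1-i$ times (so $M_1=\{1\}$, $M_2=\{1,1,2\}$, $M_3=\{1,1,1,2,2,3\}$, etc.); multiplicities multiply in the product, and all sums and counts over $\mathcal{A}_n$ are with multiplicity.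 A descent of $\sigma \in \mathcal{A}_n$ is an index $i \in [n-2]$ with $\sigma_i \ge \sigma_{i+1}$; an ascent is an index $i \in [n-2]$ with $\sigma_i < \sigma_{i+1}$. $\mathrm{lpeak}(\sigma)$ is the number of descents $i \in [n-2]$ of $\sigma$ for which either $i=1$ or $i-1$ is an ascent of $\sigma$. $\mathcal{A}^{\pm}_n$ is the multiset of all signed elements of $\mathcal{A}_n$, i.e. sequences of nonzero integers $\tau = (\tau_1,\dots,\tau_{n-1})$ such that $(|\tau_1|,\dots,|\tau_{n-1}|) \in \mathcal{A}_n$ (each $\tau$ has the multiplicity of $(|\tau_1|,\dots,|\tau_{n-1}|)$ in $\mathcal{A}_n$). For $\tau \in \mathcal{A}^{\pm}_n$, set $\tau_0 := 0$ and let $\mathrm{edes}_B(\tau)$ be the number of indices $i \in \{0,1,\dots,n-2\}$ for which $\tau_i > \tau_{i+1}$ or $\tau_i = \tau_{i+1} > 0$. *)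

(* Defs.v *)
From mathcomp Require Import all_boot all_order all_algebra.

Set Implicit Arguments.
Unset Strict Implicit.
Unset Printing Implicit Defensive.

Import Order.TTheory GRing.Theory Num.Theory.

(* A simplicial complex is given by its set of faces, the empty face included;
   the ambient finite type T may contain points that are not vertices. *)
Definition is_complex (T : finType) (D : {set {set T}}) : bool :=
  (set0 \in D) && [forall F in D, powerset F \subset D].

(* The number of faces with k elements, i.e. f_(k-1). *)
Definition fnum (T : finType) (D : {set {set T}}) (k : nat) : nat :=
  #|[set F in D | #|F| == k]|.

(* The number d such that dim D = d - 1. *)
Definition rank_complex (T : finType) (D : {set {set T}}) : nat :=
  \max_(F in D) #|F|.

Definition h_poly (T : finType) (D : {set {set T}}) : {poly int} :=
  let d := rank_complex D in
  (\sum_(i < d.+1) (fnum D i)%:R *: ('X^i * (1 - 'X) ^+ (d - i)))%R.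

Definition is_chain (T : finType) (C : {set {set T}}) : bool :=
  [forall F in C, forall G in C, (F \subset G) || (G \subset F)].

Definition sd (T : finType) (D : {set {set T}}) : {set {set {set T}}} :=
  [set C : {set {set T}} | (C \subset D :\ set0) && is_chain C].

Definition bd_simplex (n : nat) : {set {set 'I_n}} :=
  [set F : {set 'I_n} | F \proper [set: 'I_n]].

Lemma bd_simplex_complex n : 0 < n -> is_complex (bd_simplex n).
Proof.
move=> n_gt0; apply/andP; split.
  by rewrite inE properE sub0set /= subset0 -cards_eq0 cardsT card_ord -lt0n.
apply/forall_inP => F; rewrite inE => pF.
by apply/subsetP => G; rewrite powersetE inE => /sub_proper_trans; apply.
Qed.

Lemma sd_complex (T : finType) (D : {set {set T}}) : is_complex (sd D).
Proof.
apply/andP; split.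
  by rewrite inE sub0set; apply/forall_inP => F; rewrite inE.
apply/forall_inP => C; rewrite inE => /andP[sCD chC].
apply/subsetP => B; rewrite powersetE inE => sBC.
rewrite (subset_trans sBC sCD) /=.
apply/forall_inP => F /(subsetP sBC) FC; apply/forall_inP => G /(subsetP sBC) GC.
by move/forall_inP/(_ F FC)/forall_inP/(_ G GC): chC.
Qed.

(* Multisets are represented by sequences: the multiplicity of x in s is
   count_mem x s, and sums over s are sums with multiplicity. *)
Definition Mset (k : nat) : seq nat :=
  flatten [seq nseq (k.+1 - i) i | i <- iota 1 k].

Fixpoint Mprod (m : nat) : seq (seq nat) :=
  if m is m'.+1 then [seq rcons w i | w <- Mprod m', i <- Mset m'.+1]
  else [:: [::]].

Definition Awords (n : nat) : seq (seq nat) := Mprod n.-1.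

(* The letters of the words in Awords n are positive, so distinct choices of
   signs give distinct signed words. *)
Fixpoint signings (w : seq nat) : seq (seq int) :=
  if w is a :: w' then
    [seq s :: t | s <- [:: Posz a; (- Posz a)%R], t <- signings w']
  else [:: [::]].

Definition signed_Awords (n : nat) : seq (seq int) :=
  flatten [seq signings w | w <- Awords n].

Lemma count_Mset k i :
  count_mem i (Mset k) = if 1 <= i <= k then k.+1 - i else 0.
Proof.
rewrite /Mset count_flatten -map_comp sumnE big_map.
under eq_bigr => j _ do rewrite /= count_nseq /= eq_sym.
have -> : (1 <= i <= k) = (i \in iota 1 k) by rewrite mem_iota add1n ltnS.
case: ifP => [ik | /negbT nik].
  rewrite (bigD1_seq i) ?iota_uniq //= eqxx mul1n big1 ?addn0 // => j ji.
  by rewrite eq_sym (negbTE ji).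
rewrite big1_seq // => j /= jk.
by case: eqP nik => // ->; rewrite jk.
Qed.

Lemma count_signings (w : seq nat) (t : seq int) :
  0 \notin w -> count_mem t (signings w) = (map absz t == w).
Proof.
elim: w t => [|a w IHw] t.
  by case: t.
rewrite inE negb_or => /andP[a_neq0 w_neq0].
rewrite /= cats0 count_cat !count_map.
case: t => [|s t]; first by rewrite !(eq_count (a2 := pred0)) ?count_pred0.
have cnt (b : int) :
    count (preim (cons b) (pred1 (s :: t))) (signings w)
      = (b == s) * (map absz t == w).
  rewrite (eq_count (a2 := fun u => (b == s) && (u == t))); last first.
    by move=> u; rewrite /= eqseq_cons.
  by case: (b == s); rewrite ?mul1n ?mul0n -?IHw //= count_pred0.
rewrite !cnt /= eqseq_cons -mulnDl -mulnb; congr (_ * _).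
case: s {cnt} => k; case: a a_neq0 => //= a _.
  by rewrite addn0 eqz_nat eq_sym.
by rewrite add0n -NegzE eq_sym.
Qed.

(* Words are indexed from 1: letter w i is the i-th letter of w for
   1 <= i <= size w. *)
Definition letter (w : seq nat) (i : nat) : nat := nth 0 w i.-1.

Definition is_descent (w : seq nat) (i : nat) : bool :=
  (1 <= i < size w) && (letter w i >= letter w i.+1).

Definition is_ascent (w : seq nat) (i : nat) : bool :=
  (1 <= i < size w) && (letter w i < letter w i.+1).

Definition lpeak (w : seq nat) : nat :=
  count (fun i => is_descent w i && ((i == 1) || is_ascent w i.-1))
        (iota 1 (size w).-1).

Definition edesB (t : seq int) : nat :=
  let t0 := (0%R : int) :: t in
  count (fun i => (t0`_i > t0`_i.+1)%R
                  || (t0`_i == t0`_i.+1)%R && (t0`_i.+1 > 0)%R)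
        (iota 0 (size t)).

(* gamma_(n,2,i) *)
Definition gamma2 (n i : nat) : nat :=
  4 ^ i * count (fun w => lpeak w == i) (Awords n).

(* Main.v *)
Require Import Defs.
From mathcomp Require Import all_boot all_order all_algebra.
From mathcomp Require Import zify ring.

(* Write P = (1 - X)^N sum_j c(j) X^j, where c is polynomial in j.  Counting
   multichains gives h(sd D) = (1 - X)^(d + 1) sum_j (sum_k f_(k-1)(D) j^k) X^j,
   and for D = sd(bd_simplex n) the coefficient at X^j is
   phi_n(j) = sum_b S(n, b) b! j^(b-1), where phi_(n+1) = (y (y + 1) phi_n)'.
   On the word side, appending a letter a or -a to all signed words of length m
   and removing the multiplicity of a produces polynomials whose series c are
   determined by a first-order recursion in a.  They are the polynomials
   rfubini p k = delta^p (k! y^(k-1)), with delta P = (y (y + 1) P)', at j for a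
   and, up to sign, at -j for -a.  The recursion telescopes, and the boundary terms
   match because of the symmetry phi_n(-1 - y) = (-1)^(n-1) phi_n(y).
   The gamma expansion holds word by word: given |tau|, an index i is counted
   by edes_B iff tau_(i+1) < 0 when |tau| ascends at i, and iff tau_i > 0
   otherwise, so that each letter contributes 1 + X, 2 X (at a left peak) or
   2 (at a valley). *)

Set Implicit Arguments.
Unset Strict Implicit.
Unset Printing Implicit Defensive.

Import Order.TTheory GRing.Theory Num.Theory.
Local Open Scope ring_scope.

(** * Power series over powers of 1 - X *)

(** Multiplication by [X] on coefficient sequences; [bdiff] is then multiplication by [1 - X]. *)
Definition shift (c : nat -> int) (i : nat) : int :=
  if i is i'.+1 then c i' else 0.

Definition bdiff (c : nat -> int) (i : nat) : int := c i - shift c i.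

(* P = (1 - X)^N * sum_i c(i) X^i. *)
Definition genfun (N : nat) (c : nat -> int) (P : {poly int}) : Prop :=
  forall i, P`_i = iter N bdiff c i.

Lemma eq_iter_bdiff N (c c' : nat -> int) :
  c =1 c' -> iter N bdiff c =1 iter N bdiff c'.
Proof.
move=> eq_c; elim: N => //= N IH i.
by rewrite /bdiff /shift IH; case: i => // i; rewrite IH.
Qed.

Lemma eq_genfun N (c c' : nat -> int) P :
  c =1 c' -> genfun N c P -> genfun N c' P.
Proof. by move=> eq_c gP i; rewrite gP; apply: eq_iter_bdiff. Qed.

Lemma genfun_inj N c P Q : genfun N c P -> genfun N c Q -> P = Q.
Proof. by move=> gP gQ; apply/polyP => i; rewrite gP gQ. Qed.

Lemma genfun0 N : genfun N (fun=> 0) 0.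
Proof.
move=> i; rewrite coef0; elim: N i => //= N IH i.
by rewrite /bdiff /shift -IH; case: i => [|i]; rewrite -?IH subr0.
Qed.

Lemma genfunD N c c' P Q : genfun N c P -> genfun N c' Q ->
  genfun N (fun i => c i + c' i) (P + Q).
Proof.
move=> gP gQ i; rewrite coefD gP gQ {gP gQ}.
elim: N i => //= N IH i; rewrite /bdiff /shift.
by case: i => [|i]; rewrite -!IH; ring.
Qed.

Lemma genfunMn N c P k :
  genfun N c P -> genfun N (fun i => c i *+ k) (P *+ k).
Proof.
move=> gP; elim: k => [|k IH]; first exact: genfun0.
rewrite mulrS; apply: eq_genfun (genfunD gP IH) => i.
by rewrite mulrS.
Qed.

Lemma genfun_sum N (I : eqType) (r : seq I) (c : I -> nat -> int)
    (P : I -> {poly int}) :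
    (forall i, i \in r -> genfun N (c i) (P i)) ->
  genfun N (fun j => \sum_(i <- r) c i j) (\sum_(i <- r) P i).
Proof.
elim: r => [|i r IH] gP.
  rewrite big_nil; apply: eq_genfun (@genfun0 N) => j; by rewrite big_nil.
rewrite big_cons.
have gr : genfun N (fun j => \sum_(i <- r) c i j) (\sum_(i <- r) P i).
  by apply: IH => k kr; apply: gP; rewrite inE kr orbT.
apply: eq_genfun (genfunD (gP i (mem_head _ _)) gr) => j.
by rewrite big_cons.
Qed.

Lemma genfunX N c P : genfun N c P -> genfun N (shift c) ('X * P).
Proof.
move=> gP i; rewrite coefXM.
have -> : iter N bdiff (shift c) i = shift (iter N bdiff c) i.
  elim: N i {gP} => //= N IH [|i]; first by rewrite /bdiff /= IH subr0.
  by rewrite /bdiff /shift !IH.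
by case: i => //= i; rewrite gP.
Qed.

Lemma genfunS N c P : genfun N (bdiff c) P -> genfun N.+1 c P.
Proof. by move=> gP i; rewrite gP iterSr. Qed.

Lemma genfunB1X N c P : genfun N c P -> genfun N.+1 c ((1 - 'X) * P).
Proof.
move=> gP i; rewrite mulrBl mul1r coefB coefXM iterS /bdiff /shift !gP.
by case: i => //= i; rewrite gP.
Qed.

(** By Pascal's rule [X^j / (1 - X)^(j + 1)] has coefficients C(m, j); the other [d - j] factors
    [1 - X] only raise the exponent. *)
Lemma genfun_binomial d j : (j <= d)%N ->
  genfun d.+1 (fun m => 'C(m, j)%:R) ('X^j * (1 - 'X) ^+ (d - j)).
Proof.
move=> le_jd; rewrite -{1}(subnK le_jd).
elim: (d - j)%N => [|k IH]; last first.
  by rewrite exprS mulrCA; apply: genfunB1X.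
rewrite mulr1 {d le_jd}; elim: j => [|j IH].
  by move=> [|i]; rewrite coef1 //= /bdiff /= !bin0.
rewrite exprS; apply: genfunS.
apply: eq_genfun (genfunX IH) => -[|i]; rewrite /bdiff /=.
  by rewrite bin0n subr0.
by rewrite binS natrD; ring.
Qed.

(** * Fubini polynomials *)

Definition eulerD (P : {poly int}) : {poly int} := ('X * ('X + 1) * P)^`().

(* The sum of b! X^(b-1) over the partitions of p + k points into b blocks in
   which k given points lie in distinct blocks; for k = 1 this is phi_(p+1). *)
Definition rfubini (p k : nat) : {poly int} := iter p eulerD ('X^(k.-1) *+ k`!).

Lemma eulerDD P Q : eulerD (P + Q) = eulerD P + eulerD Q.
Proof. by rewrite /eulerD mulrDr derivD. Qed.

Lemma eulerDMn P k : eulerD (P *+ k) = eulerD P *+ k.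
Proof. by rewrite /eulerD mulrnAr derivMn. Qed.

Lemma eulerDXn k : eulerD 'X^k = 'X^(k.+1) *+ k.+2 + 'X^k *+ k.+1.
Proof.
rewrite /eulerD mulrDr mulr1 mulrDl -expr2 -exprD -exprS derivD !derivXn.
by [].
Qed.

Lemma rfubiniS p k : rfubini p.+1 k = eulerD (rfubini p k).
Proof. by []. Qed.

(** For [p = 0] this is [eulerDXn] times [k!]; linearity of [eulerD] carries it to every [p]. *)
Lemma rfubini_rec p k : (0 < k)%N ->
  rfubini p.+1 k = rfubini p k.+1 + rfubini p k *+ k.
Proof.
move=> k_gt0; elim: p => [|p IH]; last first.
  by rewrite rfubiniS {1}IH eulerDD eulerDMn -!rfubiniS.
case: k k_gt0 => // k _; rewrite /rfubini /= eulerDMn eulerDXn.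
by rewrite mulrnDl -!mulrnA -factS mulnC.
Qed.

(** [X (X + 1)] is invariant under y -> -1 - y, and the chain rule contributes the sign. *)
Lemma eulerD_comp P : eulerD (P \Po (- 1 - 'X)) = - (eulerD P \Po (- 1 - 'X)).
Proof.
rewrite /eulerD.
have -> : 'X * ('X + 1) * (P \Po (-1 - 'X))
   = ('X * ('X + 1) * P) \Po (- 1 - 'X) :> {poly int}.
  rewrite !comp_polyM comp_polyD comp_polyX comp_polyC.
  ring.
by rewrite deriv_comp derivB derivN derivX derivC oppr0 sub0r mulrN1.
Qed.

Lemma fubini_sym p (y : int) :
  (rfubini p 1).[- 1 - y] = (-1) ^+ p * (rfubini p 1).[y].
Proof.
have eq_comp : rfubini p 1 \Po (- 1 - 'X) = (-1) ^+ p *: rfubini p 1.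
  elim: p => [|p IH]; first by rewrite /rfubini /= comp_polyC scale1r.
  rewrite rfubiniS.
  rewrite -[LHS]opprK -eulerD_comp IH exprS mulN1r scaleNr; congr (- _).
  by rewrite /eulerD -scalerAr derivZ.
by move/(congr1 (horner^~ y)): eq_comp; rewrite hornerZ horner_comp !hornerE.
Qed.

(** * Faces of barycentric subdivisions *)

(* The number of surjections from an n-set onto a j-set. *)
Fixpoint surj (n j : nat) : nat :=
  match n, j with
  | 0, 0 => 1
  | n'.+1, j'.+1 => j * (surj n' j + surj n' j')
  | _, _ => 0
  end.

Lemma surj_small n j : (n < j)%N -> surj n j = 0%N.
Proof.
elim: n j => [|n IH] [|j] //= lt_nj.
by rewrite !IH ?muln0 // ltnW.
Qed.

Lemma surj_diag n : (0 < surj n n)%N.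
Proof. by elim: n => //= n IH; rewrite muln_gt0 /= addn_gt0 IH orbT. Qed.

(** Both sides count maps from an n-set to j + 1 classes of which only a marked one may be empty;
    [i] is the number of points outside it. *)
Lemma sum_bin_surj n j :
  (\sum_(i < n.+1) 'C(n, i) * surj i j = surj n j + surj n j.+1)%N.
Proof.
elim: n j => [|n IH] j.
  by rewrite big_ord_recl big_ord0 bin0; case: j.
rewrite big_ord_recl bin0 mul1n.
under eq_bigr => i _ do rewrite binS mulnDl.
rewrite big_split /= addnA.
have -> : (surj 0 j + \sum_(i < n.+1) 'C(n, i.+1) * surj i.+1 j
           = surj n j + surj n j.+1)%N.
  rewrite -IH [RHS]big_ord_recl bin0 mul1n big_ord_recr /= bin_small //.
  by rewrite mul0n addn0.
case: j => [|j] /=.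
  by rewrite big1 => [|i _]; rewrite ?muln0 // mul1n addn0 add0n addnC.
under eq_bigr => i _ do rewrite mulnCA mulnDr.
rewrite -big_distrr big_split /= !IH; ring.
Qed.

Lemma sum_bin_surj_lt n j :
  (\sum_(i < n) 'C(n, i) * surj i j = surj n j.+1)%N.
Proof.
have := sum_bin_surj n j; rewrite big_ord_recr /= binn mul1n addnC.
by move/addnI.
Qed.

(** Maps from an n-set to an m-set, sorted by their image. *)
Lemma sum_surj_bin n m d : (n <= d)%N ->
  (\sum_(j < d.+1) surj n j * 'C(m, j) = m ^ n)%N.
Proof.
move=> le_nd.
have -> : (\sum_(j < d.+1) surj n j * 'C(m, j)
           = \sum_(j < n.+1) surj n j * 'C(m, j))%N.
  rewrite [RHS](big_ord_widen d.+1 (fun j => surj n j * 'C(m, j))%N) //.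
  rewrite [RHS]big_mkcond; apply: eq_bigr => i _ /=.
  by case: ltnP => // lt_ni; rewrite surj_small.
elim: n {d le_nd} => [|n IH].
  by rewrite big_ord_recl big_ord0 bin0.
rewrite big_ord_recl add0n expnS -IH.
under eq_bigr => i _ do rewrite lift0 /= mulnDr mulnDl.
rewrite big_split /= big_ord_recr /= surj_small // muln0 mul0n addn0.
rewrite big_distrr /=.
have -> : (\sum_(i < n) i.+1 * surj n i.+1 * 'C(m, i.+1)
           = \sum_(i < n.+1) i * surj n i * 'C(m, i))%N.
  by rewrite [RHS]big_ord_recl.
rewrite -big_split /=; apply: eq_bigr => i _.
(* Subtraction is truncated: [m] splits as (m - i) + i only if [i <= m]; otherwise both binomials
   vanish. *)
have := mul_bin_left m i.
case: (leqP i m) => [le_im|lt_mi] eqb; last first.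
  by rewrite !bin_small ?muln0 // ltnW.
rewrite -(subnK le_im) mulnDl in eqb *.
rewrite (subnK le_im) in eqb *.
have -> : (i.+1 * surj n i * 'C(m, i.+1) = surj n i * (i.+1 * 'C(m, i.+1)))%N.
  ring.
rewrite eqb; ring.
Qed.

Section Chains.
Variable T : finType.
Implicit Types (D C : {set {set T}}) (F G : {set T}).

(** A member of largest cardinality contains all others, so [cover] gives the top of a nonempty
    chain. *)
Lemma chain_cover_in C : is_chain C -> C != set0 -> cover C \in C.
Proof.
move=> chC /set0Pn[F0 F0C].
have [F FC maxF] := @arg_maxnP _ F0 (mem C) (fun F => #|F|) F0C.
suff -> : cover C = F by [].
apply/eqP; rewrite eqEsubset (bigcup_sup F) // andbT.
apply/bigcupsP => G GC.
have /orP[//|sFG] := forall_inP (forall_inP chC G GC) F FC.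
have : F == G by rewrite eqEcard sFG; exact: maxF.
by move/eqP ->.
Qed.

Lemma chainS C (B : {set {set T}}) : B \subset C -> is_chain C -> is_chain B.
Proof.
move=> /subsetP sBC chC; apply/forall_inP => F FB; apply/forall_inP => G GB.
by apply: (forall_inP (forall_inP chC F _) G _); apply: sBC.
Qed.

(** Chains with top [F]. Through [cover] the empty chain has a top as well, namely [set0]. *)
Definition chains_below F j : {set {set {set T}}} :=
  [set C | [&& is_chain C, set0 \notin C, #|C| == j & cover C == F]].

(** Removing [F] leaves a chain whose top is a proper subset of [F]. *)
Lemma card_chains_belowS F j :
  #|chains_below F j.+1|
  = (\sum_(G : {set T} | G \proper F) #|chains_below G j|)%N.
Proof.
rewrite -sum1_card.
rewrite (reindex_onto (fun C => F |: C) (fun C => C :\ F)) /=; last first.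
  move=> C; rewrite inE => /and4P[chC n0 /eqP cC /eqP cov].
  rewrite setD1K // -cov chain_cover_in //.
  by rewrite -card_gt0 cC.
rewrite (eq_bigl (fun C : {set {set T}} =>
  [&& is_chain C, set0 \notin C, #|C| == j & cover C \proper F])).
  rewrite (partition_big (@cover T) (fun G => G \proper F)) /=; last first.
    by move=> C /and4P[].
  apply: eq_bigr => G pGF; rewrite -sum1_card; apply: eq_bigl => C.
  rewrite inE; case: (cover C =P G) => [->|]; last by rewrite !andbF.
  by rewrite pGF !andbT.
move=> C; rewrite inE.
have covE : cover (F |: C) = F :|: cover C.
  by rewrite /cover bigcup_setU big_set1.
apply/idP/idP.
  case/andP=> /and4P[chC n0 /eqP cC /eqP cov] /eqP eqC.
  have FnC : F \notin C by rewrite -eqC !inE eqxx.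
  have chC' : is_chain C by apply: chainS chC; apply: subsetU1.
  rewrite !inE negb_or in n0; case/andP: n0 => n0F n0.
  rewrite cardsU1 FnC add1n in cC; case: cC => cC.
  rewrite chC' n0 cC eqxx /= properEneq -{2}cov covE subsetUr andbT.
  have [C0|Cn0] := eqVneq C set0.
    by rewrite C0 /cover big_set0.
  by apply: contraNneq FnC => <-; apply: chain_cover_in.
case/and4P=> chC n0 /eqP cC pF.
have FnC : F \notin C.
  apply: contraTN pF => FC; rewrite properE negb_and negbK orbC.
  by rewrite (bigcup_sup F).
have sF G : G \in C -> G \subset F.
  by move=> GC; apply: subset_trans (proper_sub pF); rewrite (bigcup_sup G).
rewrite covE cardsU1 FnC cC add1n eqxx /=.
rewrite setU1K // eqxx andbT (setUidPl (proper_sub pF)) eqxx andbT.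
apply/andP; split.
  apply/forall_inP => G /setU1P[->|GC]; apply/forall_inP => G' /setU1P[->|GC'].
  - by rewrite subxx.
  - by rewrite (sF _ GC') orbT.
  - by rewrite sF.
  by exact: (forall_inP (forall_inP chC G GC) G' GC').
rewrite !inE negb_or n0 andbT eq_sym -proper0.
exact: sub_proper_trans (sub0set _) pF.
Qed.

Lemma sum_subsets_card (g : nat -> nat) (p : pred nat) F :
  (\sum_(G : {set T} | (G \subset F) && p #|G|) g #|G|
   = \sum_(i < #|F|.+1 | p i) 'C(#|F|, i) * g i)%N.
Proof.
(* The [minn] only makes the index an ordinal for every [G]; for subsets of [F] it is [#|G|]. *)
have lt_card G : (minn #|G| #|F| < #|F|.+1)%N by rewrite ltnS geq_minr.
rewrite (partition_big (fun G => Ordinal (lt_card G)) (fun i => p i)) /=; last first.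
  by move=> G /andP[sGF]; rewrite (minn_idPl (subset_leq_card sGF)).
apply: eq_bigr => i pi.
rewrite -cards_draws -sum1dep_card big_distrl /=.
apply: eq_big => [G|G /andP[/andP[sGF _] /eqP <-] /=]; last first.
  by rewrite mul1n (minn_idPl (subset_leq_card sGF)).
rewrite -val_eqE /=; case sGF: (G \subset F) => //=.
rewrite (minn_idPl (subset_leq_card sGF)).
by case: (_ =P _) => [->|]; rewrite ?andbF ?pi.
Qed.

(** Successive differences along a chain form an ordered partition of [F] into [j] blocks, the
    fibres of a surjection. *)
Lemma card_chains_below F j : #|chains_below F j| = surj #|F| j.
Proof.
elim: j F => [|j IH] F.
  have -> : surj #|F| 0 = (F == set0) by rewrite -cards_eq0; case: #|F|.
  have [->|Fn0] := eqVneq F set0.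
    rewrite -[RHS](cards1 (set0 : {set {set T}})); apply: eq_card => C.
    rewrite !inE cards_eq0; have [->|] := eqVneq C set0; last by rewrite !andbF.
    rewrite /cover big_set0 eqxx inE !andbT.
    by apply/forall_inP => ?; rewrite inE.
  apply/eqP; rewrite cards_eq0; apply/eqP/setP => C; rewrite !inE cards_eq0.
  apply/negP => /and4P[_ _ /eqP->].
  by rewrite /cover big_set0 eq_sym (negbTE Fn0).
rewrite card_chains_belowS.
under eq_bigr => G _ do rewrite IH.
rewrite -sum_bin_surj_lt.
rewrite (eq_bigl (fun G => (G \subset F) && (#|G| < #|F|)%N)); last first.
  by move=> G; rewrite properEcard.
rewrite (sum_subsets_card (fun k => surj k j) (fun k => k < #|F|)%N).
rewrite big_mkcond big_ord_recr /= ltnn addn0.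
by apply: eq_bigr => i _; rewrite ltn_ord.
Qed.

Lemma card_le_rank D F : F \in D -> (#|F| <= rank_complex D)%N.
Proof. by move=> FD; rewrite /rank_complex (bigD1 F) //= leq_maxl. Qed.

Lemma sum_fnum D (g : nat -> nat) :
  (\sum_(F in D) g #|F| = \sum_(k < (rank_complex D).+1) fnum D k * g k)%N.
Proof.
pose r := rank_complex D.
have lt_card F : (minn #|F| r < r.+1)%N by rewrite ltnS geq_minr.
rewrite (partition_big (fun G => Ordinal (lt_card G)) xpredT) //=.
apply: eq_bigr => i _.
rewrite /fnum -sum1_card big_distrl /=.
apply: eq_big => [F|F /andP[FD /eqP <-] /=]; last first.
  by rewrite mul1n (minn_idPl (card_le_rank FD)).
rewrite !inE -val_eqE /=; case FD: (F \in D) => //=.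
by rewrite (minn_idPl (card_le_rank FD)).
Qed.

(** Chains are sorted by their top; since [D] is closed under subsets, a top in [D] puts all members
    in [D]. *)
Lemma fnum_sd D j : is_complex D ->
  fnum (sd D) j = (\sum_(k < (rank_complex D).+1) fnum D k * surj k j)%N.
Proof.
case/andP=> D0 /forall_inP Dsub.
rewrite -(sum_fnum D (fun k => surj k j)) /fnum -sum1_card.
rewrite (partition_big (@cover T) (fun F => F \in D)) /=; last first.
  move=> C; rewrite !inE => /andP[/andP[sCD chC] _].
  have [->|Cn0] := eqVneq C set0; first by rewrite /cover big_set0.
  by have /(subsetP sCD) := chain_cover_in chC Cn0; rewrite !inE => /andP[].
apply: eq_bigr => F FD; rewrite -card_chains_below -sum1_card.
apply: eq_bigl => C; rewrite !inE.
apply/idP/idP => [/andP[/andP[/andP[sCD ->]] -> ->]|].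
  by rewrite !andbT /=; apply/negP => /(subsetP sCD); rewrite !inE eqxx.
case/and4P=> -> n0 -> /eqP cov; rewrite cov eqxx !andbT.
apply/subsetP => G GC; rewrite !inE; apply/andP; split.
  by apply: contraNneq n0 => <-.
by apply: (subsetP (Dsub F FD)); rewrite powersetE -cov (bigcup_sup G).
Qed.

(** Reads the rank off the face numbers alone. *)
Lemma rank_complexP D d : D != set0 ->
  rank_complex D = d <->
  (0 < fnum D d)%N /\ forall j, (d < j)%N -> fnum D j = 0%N.
Proof.
move=> /set0Pn[F0 F0D].
have rankP r : (0 < fnum D r)%N -> (r <= rank_complex D)%N.
  by case/card_gt0P=> F; rewrite inE => /andP[/card_le_rank + /eqP <-].
have rank_gt0 : (0 < fnum D (rank_complex D))%N.
  have D_gt0 : (0 < #|D|)%N by apply/card_gt0P; exists F0.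
  have [F FD eqF] := eq_bigmax_cond (fun F : {set T} => #|F|) D_gt0.
  apply/card_gt0P; exists F; rewrite inE FD /= /rank_complex eqF.
  by apply/eqP.
split=> [<-|[gt0 eq0]].
  split=> // j lt_j; apply/eqP; rewrite -leqn0 leqNgt.
  by apply: contraTN lt_j => /rankP; rewrite leqNgt.
apply/eqP; rewrite eqn_leq rankP // andbT leqNgt.
by apply: contraTN rank_gt0 => /eq0 ->.
Qed.

End Chains.

Lemma complex_neq0 (T : finType) (D : {set {set T}}) :
  is_complex D -> D != set0.
Proof. by case/andP=> D0 _; apply/set0Pn; exists set0. Qed.

Lemma rank_sd (T : finType) (D : {set {set T}}) :
  is_complex D -> rank_complex (sd D) = rank_complex D.
Proof.
move=> cD; have [gt0 _] := (rank_complexP _ (complex_neq0 cD)).1 erefl.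
apply/(rank_complexP _ (complex_neq0 (sd_complex D))); split=> [|j lt_j].
  by rewrite fnum_sd // big_ord_recr /= addn_gt0 muln_gt0 gt0 surj_diag orbT.
rewrite fnum_sd // big1 // => i _; rewrite surj_small ?muln0 //.
by apply: leq_trans lt_j; rewrite ltn_ord.
Qed.

Lemma fnum_bd_simplex n k :
  fnum (bd_simplex n) k = if (k < n)%N then 'C(n, k) else 0%N.
Proof.
rewrite /fnum; case: ltnP => [lt_kn|le_nk].
  rewrite -[in RHS](card_ord n) -card_draws; apply: eq_card => F.
  rewrite !inE properEcard subsetT cardsT card_ord /=.
  by case: (_ =P _) => [->|]; rewrite ?lt_kn ?andbF.
apply/eqP; rewrite cards_eq0; apply/eqP/setP => F.
rewrite !inE properEcard subsetT cardsT card_ord /=.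
by case: (_ =P _) => [->|]; rewrite ?andbF // ltnNge le_nk.
Qed.

Lemma rank_bd_simplex n : rank_complex (bd_simplex n.+1) = n.
Proof.
apply/(rank_complexP _ (complex_neq0 (bd_simplex_complex (ltn0Sn n)))).
split=> [|j lt_j]; rewrite fnum_bd_simplex ?ltnSn ?bin_gt0 //.
by rewrite ltnNge lt_j.
Qed.

(** The complement of the top is nonempty and serves as the last of k + 1 blocks. *)
Lemma fnum_sd_bd_simplex n k : fnum (sd (bd_simplex n.+1)) k = surj n.+1 k.+1.
Proof.
rewrite fnum_sd ?bd_simplex_complex // rank_bd_simplex -sum_bin_surj_lt.
by apply: eq_bigr => i _; rewrite fnum_bd_simplex ltn_ord.
Qed.

(** * Signed words *)

Definition desB (s a : int) : bool := (s > a) || (s == a) && (a > 0).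

Fixpoint edes (s : int) (t : seq int) : nat :=
  if t is a :: t' then (desB s a + edes a t')%N else 0%N.

Lemma edesBE t : edesB t = edes 0 t.
Proof.
pose des_at s t i := desB (s :: t)`_i (s :: t)`_i.+1.
suff edesE s : count (des_at s t) (iota 0 (size t)) = edes s t by rewrite -edesE.
elim: t s => [|a t IH] s //=.
rewrite -IH (iotaDl 1 0) count_map; congr (_ + _)%N.
Qed.

(* The state is the last letter b of an unsigned word with the sums of
   X^edes over its signings that end in b and in -b, respectively. *)
Definition sign_step (q : nat * {poly int} * {poly int}) (a : nat) :=
  (a, if (q.1.1 < a)%N then q.1.2 + q.2 else 'X * q.1.2 + q.2,
      if (q.1.1 < a)%N then 'X * (q.1.2 + q.2) else 'X * q.1.2 + q.2).

(** The initial 0 is [tau_0], smaller than every letter; it carries no sign, so its weight sits in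
    one component. *)
Definition sign_state (w : seq nat) := foldl sign_step (0%N, 1, 0) w.

Definition total (q : nat * {poly int} * {poly int}) : {poly int} := q.1.2 + q.2.

Lemma total_foldl (w : seq nat) b A B : all (leq 1) w ->
  total (foldl sign_step (b, A, B) w)
   = A * (\sum_(t <- signings w) 'X^(edes (Posz b) t))
     + B * (\sum_(t <- signings w) 'X^(edes (- Posz b) t)).
Proof.
elim: w b A B => [|a w IH] b A B /=.
  by move=> _; rewrite !big_seq1 /= !expr0 !mulr1.
case/andP=> a_gt0 w_gt0; rewrite /sign_step /= IH //.
rewrite cats0 !big_cat !big_map /=.
have E s c : \sum_(t <- signings w) 'X^(desB s c + edes c t)
   = 'X^(desB s c) * \sum_(t <- signings w) 'X^(edes c t) :> {poly int}.
  by rewrite big_distrr /=; apply: eq_bigr => t _; rewrite exprD.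
(* If [b < a], exactly the steps into [-a] count; otherwise exactly the steps out of [+b]. *)
rewrite !E; case: ltnP => lt_ba.
  have -> : desB b a = false by rewrite /desB; lia.
  have -> : desB b (- a%:Z) by rewrite /desB; lia.
  have -> : desB (- b%:Z) a = false by rewrite /desB; lia.
  have -> : desB (- b%:Z) (- a%:Z) by rewrite /desB; lia.
  ring.
have -> : desB b a by rewrite /desB; lia.
have -> : desB b (- a%:Z) by rewrite /desB; lia.
have -> : desB (- b%:Z) a = false by rewrite /desB; lia.
have -> : desB (- b%:Z) (- a%:Z) = false by rewrite /desB; lia.
ring.
Qed.

Lemma sum_signings w : all (leq 1) w ->
  \sum_(t <- signings w) 'X^(edesB t) = total (sign_state w).
Proof.
move=> w_gt0; rewrite total_foldl // mul1r mul0r addr0.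
by apply: eq_bigr => t _; rewrite edesBE.
Qed.

Lemma sign_state_last w : (sign_state w).1.1 = last 0%N w.
Proof.
by case/lastP: w => // w a; rewrite /sign_state foldl_rcons last_rcons.
Qed.

(** * Left peaks and the gamma expansion *)

(* b is the letter preceding w, and f tells whether the step into b is an
   ascent (true at the start of a word). *)
Fixpoint lpeak_rec (f : bool) (b : nat) (w : seq nat) : nat :=
  if w is a :: w' then
    if (b < a)%N then lpeak_rec true a w' else (f + lpeak_rec false a w')%N
  else 0%N.

Lemma lpeakE b w : lpeak (b :: w) = lpeak_rec true b w.
Proof.
pose lp f v :=
  count (fun i => is_descent v i
                  && (if i == 1%N then f else is_ascent v i.-1))
        (iota 1 (size v).-1).
have -> : lpeak (b :: w) = lp true (b :: w).
  apply: eq_count => i; case: (i == 1%N) => //=.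
elim: w true b => [|a w IH] f b //=.
transitivity ((a <= b)%N && f + lp (b < a)%N (a :: w))%N.
  rewrite /lp /= (iotaDl 1 1) count_map; congr (_ + _)%N.
  apply: eq_in_count => i. rewrite mem_iota. case: i => [|[|i]] //= lt_i.
by rewrite IH; case: ltnP => //=; rewrite ?andbT //; case: f.
Qed.

Lemma total_foldl_lpeak f b w (Q : {poly int}) :
  let p := lpeak_rec f b w in
  (p.*2 <= f + size w)%N /\
  total (foldl sign_step (b, Q, if f then 'X * Q else Q) w)
    = Q * (if f then 1 else 2%:R) * (4%:R * 'X) ^+ p
      * (1 + 'X) ^+ (f + size w - p.*2).
Proof.
elim: w f b Q => [|a w IH] f b Q /=.
  by case: f; split; rewrite // /total /= ?expr0 ?expr1 /=; ring.
rewrite /sign_step /=; case: ltnP => lt_ba.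
  case: f => /=.
    have [le_p ->] := IH true a (Q + 'X * Q); split; first lia.
    have -> : (true + (size w).+1 - (lpeak_rec true a w).*2
      = (true + size w - (lpeak_rec true a w).*2).+1)%N by lia.
    by rewrite exprS; ring.
  have [le_p eqp] := IH true a (Q + Q); split; first lia.
  by rewrite eqp /=; ring.
case: f => /=.
  have [le_p eqp] := IH false a ('X * Q + 'X * Q); split; first lia.
  have -> : (1 + (size w).+1 - (1 + lpeak_rec false a w).*2
     = 0 + size w - (lpeak_rec false a w).*2)%N by lia.
  by rewrite eqp /= add1n exprS; ring.
have [le_p eqp] := IH false a ('X * Q + Q); split; first lia.
have -> : (false + (size w).+1 - (lpeak_rec false a w).*2
  = (false + size w - (lpeak_rec false a w).*2).+1)%N by lia.
by rewrite eqp exprS /=; ring.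
Qed.

Lemma total_sign_state_lpeak w : w != [::] -> all (leq 1) w ->
  ((lpeak w).*2 <= size w)%N /\
  total (sign_state w)
  = (4%:R * 'X) ^+ lpeak w * (1 + 'X) ^+ (size w - (lpeak w).*2).
Proof.
case: w => // a w _ /= /andP[a_gt0 _].
rewrite lpeakE /sign_state /= /sign_step /= a_gt0.
have [le_p ->] := total_foldl_lpeak true a w (1 + 0).
by split=> //; rewrite addr0 !mul1r.
Qed.

(** * Recursion on the last letter *)

Lemma sum_Mset (V : nmodType) k (g : nat -> V) :
  \sum_(i <- Mset k) g i = \sum_(1 <= i < k.+1) g i *+ (k.+1 - i).
Proof.
rewrite /Mset big_flatten big_map /index_iota subSS subn0.
by apply: eq_bigr => i _; rewrite big_nseq iter_addr addr0.
Qed.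

Lemma sum_Mprod (V : nmodType) m (g : seq nat -> V) :
  \sum_(w <- Mprod m.+1) g w
  = \sum_(1 <= i < m.+2) (\sum_(w <- Mprod m) g (rcons w i)) *+ (m.+2 - i).
Proof.
have -> : Mprod m.+1 = [seq rcons w i | w <- Mprod m, i <- Mset m.+1] by [].
rewrite big_allpairs_dep.
under eq_bigr => w _ do rewrite sum_Mset.
by rewrite exchange_big /=; apply: eq_bigr => i _; rewrite -sumrMnl.
Qed.

Lemma mem_Mset k i : (i \in Mset k) = (1 <= i <= k)%N.
Proof.
by rewrite -has_pred1 has_count count_Mset; case: ifP => // /andP[_ ?];
   rewrite subn_gt0.
Qed.

Lemma mem_Mprod m w : w \in Mprod m ->
  size w = m /\ all (fun a => 1 <= a <= m)%N w.
Proof.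
elim: m w => [|m IH] w; first by rewrite inE => /eqP->.
move/(@allpairsP _ _ _ rcons)=> [[v i] /= [/IH[sv av]]].
rewrite (mem_Mset m.+1) => iP ->.
rewrite size_rcons sv all_rcons iP; split=> //=.
by apply: sub_all av => a; lia.
Qed.

Lemma Mprod_pos m w : w \in Mprod m -> all (leq 1) w.
Proof. by case/mem_Mprod => _; apply: sub_all => a /andP[]. Qed.

(* Signed words of length m followed by a (resp. -a), without the multiplicity
   of a in Mset m.+1. *)
Definition ext_pos (m a : nat) : {poly int} :=
  \sum_(w <- Mprod m) (sign_step (sign_state w) a).1.2.
Definition ext_neg (m a : nat) : {poly int} :=
  \sum_(w <- Mprod m) (sign_step (sign_state w) a).2.

Lemma sign_state_rcons w i : sign_state (rcons w i) = sign_step (sign_state w) i.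
Proof. by rewrite /sign_state foldl_rcons. Qed.

Lemma ext_posS m a : ext_pos m.+1 a
  = \sum_(1 <= i < m.+2)
      (if (i < a)%N then ext_pos m i + ext_neg m i
       else 'X * ext_pos m i + ext_neg m i)
        *+ (m.+2 - i).
Proof.
rewrite /ext_pos sum_Mprod; apply: eq_bigr => i _; congr (_ *+ _).
under eq_bigr => w _ do rewrite sign_state_rcons {1}/sign_step /=.
rewrite /ext_neg; case: ltnP => _; first by rewrite big_split.
by rewrite big_split /= -big_distrr.
Qed.

Lemma ext_negS m a : ext_neg m.+1 a
  = \sum_(1 <= i < m.+2)
      (if (i < a)%N then 'X * (ext_pos m i + ext_neg m i)
       else 'X * ext_pos m i + ext_neg m i)
        *+ (m.+2 - i).
Proof.
rewrite /ext_neg sum_Mprod; apply: eq_bigr => i _; congr (_ *+ _).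
under eq_bigr => w _ do rewrite sign_state_rcons {1}/sign_step /=.
rewrite /ext_pos; case: ltnP => _; first by rewrite -big_distrr big_split.
by rewrite big_split /= -big_distrr.
Qed.

Lemma big_nat_if (V : nmodType) k a l (F G : nat -> V) (c : nat -> nat) :
    (k <= a)%N -> (a <= l)%N ->
  \sum_(k <= i < l) (if (i < a)%N then F i else G i) *+ c i
  = \sum_(k <= i < a) F i *+ c i + \sum_(a <= i < l) G i *+ c i.
Proof.
move=> le_ka le_al; rewrite (big_cat_nat le_ka le_al); congr (_ + _).
  by apply: eq_big_nat => i /andP[_ ->].
by apply: eq_big_nat => i /andP[le_ai _]; rewrite ltnNge le_ai.
Qed.

Definition coef_pos (m a j : nat) : int := (rfubini a.-1 (m.+2 - a)).[j%:R].
(** A word ending in [-a] has a descent, so [ext_neg] has no constant term; the formula in [rfubini]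
    would fail at [j = 0]. *)
Definition coef_neg (m a j : nat) : int :=
  if j is 0 then 0 else (-1) ^+ m * (rfubini a.-1 (m.+2 - a)).[- j%:R].

(** By [rfubini_rec] the multiplicity of the letter [i] becomes a difference in [i], so that sums
    over letters telescope. *)
Lemma coef_pos_step m i j : (0 < i < m.+2)%N ->
  coef_pos m i j *+ (m.+2 - i) = coef_pos m.+1 i.+1 j - coef_pos m.+1 i j.
Proof.
case: i => // i /= lt_im; rewrite /coef_pos !succnK.
have -> : (m.+3 - i.+1 = (m.+2 - i.+1).+1)%N by lia.
have -> : (m.+3 - i.+2 = m.+2 - i.+1)%N by lia.
by rewrite rfubini_rec ?subn_gt0 // hornerD hornerMn addrC addKr.
Qed.

Lemma coef_neg_step m i j : (0 < i < m.+2)%N ->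
  coef_neg m i j *+ (m.+2 - i) = coef_neg m.+1 i j - coef_neg m.+1 i.+1 j.
Proof.
case: j => [|j]; first by rewrite /= mul0rn subrr.
case: i => // i /andP[_ lt_im]; rewrite /coef_neg ?succnK.
have -> : (m.+3 - i.+1 = (m.+2 - i.+1).+1)%N by lia.
have -> : (m.+3 - i.+2 = m.+2 - i.+1)%N by lia.
rewrite rfubini_rec ?subn_gt0 // hornerD hornerMn.
by rewrite exprS -mulrnAr; ring.
Qed.

(** Both sides are (m + 2)! j^(m + 1), since the two signs cancel. *)
Lemma coef_pos1 m j : coef_pos m.+1 1 j = coef_neg m.+1 1 j.
Proof.
rewrite /coef_pos /coef_neg /rfubini /= !subSS subn0 /= !hornerMn !hornerXn.
case: j => [|j]; first by rewrite expr0n mul0rn.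
by rewrite mulrnAr -exprMn mulN1r opprK.
Qed.

(** For [j > 0], this is [fubini_sym] at y = j - 1. *)
Lemma coef_neg_last m j : coef_neg m m.+1 j = shift (coef_pos m m.+1) j.
Proof.
rewrite /coef_neg; case: j => //= j; rewrite /coef_pos /= subSnn.
have := fubini_sym m j%:R; rewrite (_ : -1 - j%:R = - j.+1%:R) => [->|].
  by rewrite mulrA -exprMn mulrNN mulr1 expr1n mul1r.
by rewrite -natr1; ring.
Qed.

Lemma genfun_ext m a : (0 < a < m.+2)%N ->
  genfun m.+1 (coef_pos m a) (ext_pos m a) /\
  genfun m.+1 (coef_neg m a) (ext_neg m a).
Proof.
elim: m a => [|m IH] a a_m.
  have -> : a = 1%N by lia.
  rewrite /ext_pos /ext_neg /= !big_seq1 /sign_state /= addr0 mulr1.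
  split=> -[|[|i]]; rewrite /= /bdiff /= /coef_pos /coef_neg /rfubini /=;
    by rewrite ?coef1 ?coefX ?hornerE /= ?hornerE.
have sum_pos k l j : (0 < k)%N -> (k <= l)%N -> (l <= m.+2)%N ->
  \sum_(k <= i < l) coef_pos m i j *+ (m.+2 - i)
  = coef_pos m.+1 l j - coef_pos m.+1 k j.
  move=> k_gt0 le_kl le_lm.
  rewrite -(telescope_sumr (fun i => coef_pos m.+1 i j) le_kl).
  by apply: eq_big_nat => i i_kl; rewrite coef_pos_step //; lia.
have sum_neg k l j : (0 < k)%N -> (k <= l)%N -> (l <= m.+2)%N ->
  \sum_(k <= i < l) coef_neg m i j *+ (m.+2 - i)
  = coef_neg m.+1 k j - coef_neg m.+1 l j.
  move=> k_gt0 le_kl le_lm; rewrite -[RHS]opprB.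
  rewrite -(telescope_sumr (fun i => coef_neg m.+1 i j) le_kl) -sumrN.
  by apply: eq_big_nat => i i_kl; rewrite coef_neg_step ?opprB //; lia.
have shift_sum k l j : (0 < k)%N -> (k <= l)%N -> (l <= m.+2)%N ->
  \sum_(k <= i < l) shift (coef_pos m i) j *+ (m.+2 - i)
    = shift (coef_pos m.+1 l) j - shift (coef_pos m.+1 k) j.
  case: j => [|j] k_gt0 le_kl le_lm /=; last exact: sum_pos.
  by rewrite big1 ?subr0 // => i _; rewrite mul0rn.
have shift_sumn k l j : (0 < k)%N -> (k <= l)%N -> (l <= m.+2)%N ->
  \sum_(k <= i < l) shift (coef_neg m i) j *+ (m.+2 - i)
    = shift (coef_neg m.+1 k) j - shift (coef_neg m.+1 l) j.
  case: j => [|j] k_gt0 le_kl le_lm /=; last exact: sum_neg.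
  by rewrite big1 ?subr0 // => i _; rewrite mul0rn.
have [a_gt0 a_le] : (0 < a)%N /\ (a <= m.+2)%N by lia.
have sh1 j : shift (coef_pos m.+1 1) j = shift (coef_neg m.+1 1) j.
  by case: j => //= j; rewrite coef_pos1.
(* The recursion in [m] has to produce the differences [bdiff] of the claimed series. *)
split; apply: genfunS.
  rewrite ext_posS; apply: (@eq_genfun _ (fun j => \sum_(1 <= i < m.+2)
    (if (i < a)%N then coef_pos m i j + coef_neg m i j
     else shift (coef_pos m i) j + coef_neg m i j) *+ (m.+2 - i))).
    move=> j; rewrite big_nat_if //.
    under eq_bigr => i _ do rewrite mulrnDl.
    under [X in _ + X]eq_bigr => i _ do rewrite mulrnDl.
    rewrite !big_split /= sum_pos // !sum_neg // shift_sum //.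
    (* The boundary terms at letters 1 and m + 2 cancel, leaving those at [a]. *)
    by rewrite coef_neg_last coef_pos1 /bdiff; ring.
  apply: genfun_sum => i; rewrite mem_index_iota => i_m.
  have [gp gn] := IH i i_m; apply: genfunMn.
  by case: ifP => _; apply: genfunD => //; apply: genfunX.
rewrite ext_negS; apply: (@eq_genfun _ (fun j => \sum_(1 <= i < m.+2)
  (if (i < a)%N then shift (coef_pos m i) j + shift (coef_neg m i) j
   else shift (coef_pos m i) j + coef_neg m i j) *+ (m.+2 - i))).
  move=> j; rewrite big_nat_if //.
  under eq_bigr => i _ do rewrite mulrnDl.
  under [X in _ + X]eq_bigr => i _ do rewrite mulrnDl.
  rewrite !big_split /= sum_neg // !shift_sum // shift_sumn //.
  by rewrite coef_neg_last sh1 /bdiff; ring.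
apply: genfun_sum => i; rewrite mem_index_iota => i_m.
have [gp gn] := IH i i_m; apply: genfunMn.
case: ifP => _; first by rewrite mulrDr; apply: genfunD; apply: genfunX.
by apply: genfunD => //; apply: genfunX.
Qed.

Lemma genfun_signed_Awords m :
  genfun m.+1 (fun j => (rfubini m 1).[j%:R])
    (\sum_(t <- signed_Awords m.+1) 'X^(edesB t)).
Proof.
(* Appending m + 1, larger than every letter, adds no descent. *)
have -> : \sum_(t <- signed_Awords m.+1) 'X^(edesB t) = ext_pos m m.+1.
  rewrite /signed_Awords big_flatten big_map /Awords /ext_pos.
  apply: eq_big_seq => w w_m; rewrite sum_signings ?(Mprod_pos w_m) //.
  rewrite /sign_step /= sign_state_last.
  suff -> : (last 0 w < m.+1)%N by [].
  have [_ /allP w_le] := mem_Mprod w_m.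
  have := mem_last 0%N w; rewrite inE => /predU1P[-> //|/w_le /andP[_]].
  by [].
have [|gp _] := @genfun_ext m m.+1; first by rewrite !ltnS leqnn.
by apply: eq_genfun gp => j; rewrite /coef_pos subSnn.
Qed.

Lemma signed_Awords_lpeak n : (0 < n)%N ->
  \sum_(t <- signed_Awords n.+1) 'X^(edesB t)
  = \sum_(0 <= i < (n %/ 2).+1)
      (gamma2 n.+1 i)%:R *: ('X^i * (1 + 'X) ^+ (n - 2 * i)) :> {poly int}.
Proof.
move=> n_gt0; rewrite /signed_Awords big_flatten big_map.
transitivity (\sum_(w <- Awords n.+1) \sum_(0 <= i < (n %/ 2).+1)
   (if lpeak w == i then (4 ^ i)%:R *: ('X^i * (1 + 'X) ^+ (n - 2 * i))
    else 0 : {poly int})).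
  apply: eq_big_seq => w w_n; rewrite sum_signings ?(Mprod_pos w_n) //.
  have [sw _] := mem_Mprod w_n.
  have [|le_p ->] := total_sign_state_lpeak _ (Mprod_pos w_n).
    by rewrite -size_eq0 sw -lt0n.
  rewrite sw in le_p *.
  have lt_p : (lpeak w < (n %/ 2).+1)%N by move: le_p => /=; lia.
  rewrite (bigD1_seq (lpeak w)) ?iota_uniq ?mem_index_iota //=.
  rewrite eqxx big1 ?addr0 => [|i /negbTE]; last by rewrite eq_sym => ->.
  by rewrite exprMn -mulrA -mul2n -natrX scaler_nat mulr_natl.
rewrite exchange_big; apply: eq_bigr => i _ /=.
rewrite -big_mkcond /= /gamma2 natrM -scalerA -sum1_count natr_sum scaler_suml.
rewrite scaler_sumr.
by apply: eq_bigr => w _; rewrite scale1r.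
Qed.

(** * The series of the h-polynomial *)

Lemma surjS n j : surj n.+1 j.+1 = (j.+1 * (surj n j.+1 + surj n j))%N.
Proof. by []. Qed.

(** On coefficients [eulerDXn] is the recursion of [surj]. *)
Lemma fubini_surj m : rfubini m 1 = \sum_(k < m.+1) 'X^k *+ surj m.+1 k.+1.
Proof.
elim: m => [|m IH]; first by rewrite /rfubini big_ord_recl big_ord0 addr0.
rewrite rfubiniS IH.
have -> : eulerD (\sum_(k < m.+1) 'X^k *+ surj m.+1 k.+1)
    = \sum_(k < m.+1) ('X^(k.+1) *+ (k.+2 * surj m.+1 k.+1)
                       + 'X^k *+ (k.+1 * surj m.+1 k.+1)).
  elim/big_rec2: _ => [|k P Q _ IHP].
    by rewrite /eulerD mulr0 deriv0.
  by rewrite eulerDD IHP eulerDMn eulerDXn mulrnDl -!mulrnA.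
under [in RHS]eq_bigr => k _ do rewrite surjS mulnDr mulrnDr.
(* The extra end terms vanish: one contains [surj m.+1 m.+2], the other [surj m.+1 0]. *)
rewrite !big_split; apply: etrans (addrC _ _) _; congr (_ + _).
  by rewrite [RHS]big_ord_recr surj_small // muln0 mulr0n /= addr0.
rewrite [RHS]big_ord_recl muln0 mulr0n /= add0r.
by apply: eq_bigr.
Qed.

(** The binomial series gives sum_j f_(j-1)(sd D) C(m, j), and [fnum_sd] with [sum_surj_bin] turns
    it into powers of [m]. *)
Lemma genfun_h_poly (T : finType) (D : {set {set T}}) : is_complex D ->
  genfun (rank_complex D).+1
    (fun m => \sum_(k < (rank_complex D).+1) (m%:R ^+ k) *+ fnum D k)
    (h_poly (sd D)).
Proof.
move=> cD; rewrite /h_poly rank_sd //.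
set d := rank_complex D.
apply: (@eq_genfun _ (fun m =>
  \sum_(j < d.+1) ('C(m, j)%:R *+ fnum (sd D) j))).
  move=> m; under eq_bigr => j _ do rewrite fnum_sd // -mulrnA mulnC big_distrl /=.
  under [in RHS]eq_bigr => k _.
    have le_kd : (k <= d)%N by rewrite -ltnS.
    rewrite -natrX -(sum_surj_bin m le_kd) -mulrnA mulnC big_distrr /=. over.
  rewrite -!natr_sum exchange_big; congr _%:R.
  by apply: eq_bigr => k _; apply: eq_bigr => j _; rewrite mulnA.
apply: genfun_sum => j _; rewrite scaler_nat; apply: genfunMn.
by apply: genfun_binomial; rewrite -ltnS.
Qed.

Theorem proposition6p1 (n : nat) (hn : (2 <= n)%N) :
  h_poly (sd (sd (bd_simplex n)))
    = \sum_(t <- signed_Awords n) 'X^(edesB t)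
  /\
  \sum_(t <- signed_Awords n) 'X^(edesB t)
    = \sum_(0 <= i < ((n - 1) %/ 2).+1)
        (gamma2 n i)%:R *: ('X^i * (1 + 'X) ^+ (n - 1 - 2 * i))
      :> {poly int}.
Proof.
case: n hn => [|m] // m_gt0; rewrite !subn1 !succnK.
split; last exact: signed_Awords_lpeak.
have := genfun_h_poly (sd_complex (bd_simplex m.+1)).
rewrite rank_sd ?bd_simplex_complex // rank_bd_simplex => gh.
(* Both polynomials have exponent m + 1, so only their series remain to be compared. *)
apply: genfun_inj gh _; apply: eq_genfun (genfun_signed_Awords m) => j.
rewrite fubini_surj horner_sum; apply: eq_bigr => k _.
by rewrite hornerMn hornerXn fnum_sd_bd_simplex.
Qed.
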